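(* For every prime $p\equiv 7\pmod{12}$ and for every $p\in\{37,61,73,109,157,181,229,277\}$, there exist a strictly $p$-cyclic $SQS(2\times p)$ and a perfect 2-D $(2\times p,4,2)$-OOC.
   Context: A strictly $v$-cyclic $SQS(u\times v)$ is a set of $4$-subsets (blocks) of $I_u\times Z_v$ ($I_u=\{0,\dots,u-1\}$) such that every $3$-subset is in exactly one block, invariant under $(i,x)\mapsto(i,x+1)$, and no block $B$ satisfies $B+\delta=B$ for nonzero $\delta\in Z_v$. A 2-D $(u\times v,4,2)$-OOC is a family of $u\times v$ $(0,1)$-matrices of weight $4$ such that for all codewords $A=(a_{ij}),B=(b_{ij})$ and integers $r$ with $A\ne B$ or $r\not\equiv0\pmod v$, $\sum_{i,j}a_{ij}b_{i,j+r}\le2$ (columns mod $v$); it is perfect if it has $u(uv-1)(uv-2)/24$ codewords. *)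

(* Defs.v *)
From HB Require Import structures.
From mathcomp Require Import all_boot all_order all_algebra.
Set Implicit Arguments. Unset Strict Implicit. Unset Printing Implicit Defensive.
Import GRing.Theory.

(* Points of I_u x Z_v.  'Z_v is Z/vZ only for v >= 2; the theorem only
   instantiates v with a prime. *)
Definition point (u v : nat) := ('I_u * 'Z_v)%type.

Definition shift_pt u v (d : 'Z_v) (x : point u v) : point u v := (x.1, (x.2 + d)%R).
Definition shift_blk u v (d : 'Z_v) (b : {set point u v}) : {set point u v} :=
  [set shift_pt d x | x in b].

Definition strictly_cyclic_SQS (u v : nat) (B : {set {set point u v}}) : Prop :=
  [/\ (forall b, b \in B -> #|b| = 4),
      (forall T : {set point u v}, #|T| = 3 -> #|[set b in B | T \subset b]| = 1),
      (forall b, b \in B -> shift_blk 1%R b \in B)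
    & (forall b d, b \in B -> d != 0%R -> shift_blk d b != b)].

Definition weight u v (A : 'M[bool]_(u, v)) : nat := \sum_(i < u) \sum_(j < v) (A i j : nat).

Definition corr u v (A B : 'M[bool]_(u, v)) (r : nat) : nat :=
  \sum_(i < u) \sum_(j < v) \sum_(k < v)
     [&& A i j, B i k & (val k == (val j + r) %% v)] .

(* C is a 2-D (u x v, 4, 2)-OOC; integers r are represented by naturals,
   which cover all residues mod v *)
Definition OOC_2D (u v : nat) (C : {set 'M[bool]_(u, v)}) : Prop :=
  (forall A, A \in C -> weight A = 4) /\
  (forall A B (r : nat), A \in C -> B \in C -> (A != B) || (r %% v != 0) ->
       corr A B r <= 2).

Definition perfect_OOC_2D (u v : nat) (C : {set 'M[bool]_(u, v)}) : Prop :=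
  OOC_2D C /\ #|C| = (u * (u * v - 1) * (u * v - 2)) %/ 24.

(* Main.v *)
Require Import Defs.
From Stdlib Require Import NArith MSetPositive.
From HB Require Import structures.
From mathcomp Require Import all_boot all_order all_algebra.
From mathcomp Require Import cyclic finfield zify ring.

Set Implicit Arguments. Unset Strict Implicit. Unset Printing Implicit Defensive.
Import GRing.Theory.

(** A Steiner quadruple system is the same thing as a totally symmetric ternary operation sending
    three distinct points to the fourth point of their block.  On {0,1} x F_p we look for such
    operations commuting with translations and with (i, x) |-> (1 - i, - x).  Strictness is
    automatic, because translating a block by d adds 4 d to the sum of its second coordinates; for
    the same reason the blocks whose coordinate sum is 0 represent every translation class exactly
    once, and they are the codewords of the perfect code.

    If p = 7 mod 12, then -1 is not a square and F_p contains a primitive cube root of unity, so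
    the PSL(2,p)-orbit of an equianharmonic quadruple is a quadruple system on F_p + {oo}.  Its
    blocks avoiding oo are used on either level; a block {oo, a, b, c} becomes {a, b, c} on one
    level together with the centroid m of a, b, c on the other level.  Finally {a, b} on one level
    is joined to the pairs {m + j(b - a), m + (j + 1)(b - a)}, j = 1, 3, ..., p - 2, on the other:
    the pairs of a mixed block have the same difference, so both levels play the same role.

    For the other primes the mixed blocks are {m - s, m + s} with {m - t, m + t} for s <> +-t, and
    {m - d, m, m + d} with m.  There remains to cover the triples on one level which are not
    arithmetic progressions by parallelograms {m - s, m + s, m - t, m + t}.  Every such triple lies
    in three parallelograms, so this is a perfect matching problem in a cubic graph. *)

(** * Quadruple systems as ternary operations *)

(** The two exchanges generate all permutations of the arguments, and the last equation lets the
    value change places with an argument. Only distinct triples are constrained, so concrete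
    operations may be total functions. *)
Definition steiner_op (V : eqType) (f : V -> V -> V -> V) : Prop :=
  forall a b c, uniq [:: a; b; c] ->
    [/\ f a b c \notin [:: a; b; c], f b a c = f a b c, f a c b = f a b c
      & f a b (f a b c) = c].

Section SteinerOp.

Variables (V : finType) (f : V -> V -> V -> V).
Hypothesis fP : steiner_op f.

(** The next three lemmas are the adjacent transpositions of the four places. They generate the
    symmetric group, so one known quadruple yields all its arrangements. *)
Let quad a b c d := uniq [:: a; b; c] /\ f a b c = d.

Let quadC a b c d : quad a b c d -> quad b a c d.
Proof.
case=> u <-; have [_ fE _ _] := fP u; split=> //.
by rewrite -(perm_uniq (s1 := [:: a; b; c])) //; apply/permP=> x /=; lia.
Qed.

Let quadCA a b c d : quad a b c d -> quad a c b d.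
Proof.
case=> u <-; have [_ _ fE _] := fP u; split=> //.
by rewrite -(perm_uniq (s1 := [:: a; b; c])) //; apply/permP=> x /=; lia.
Qed.

Let quadK a b c d : quad a b c d -> quad a b d c.
Proof.
case=> u <-; have [dN _ _ dK] := fP u; split=> //.
by move: u dN; rewrite /= !inE !(eq_sym (f a b c)); lia.
Qed.

Definition blk a b c : {set V} := [set a; b; c; f a b c].

Lemma card_blk a b c : uniq [:: a; b; c] -> #|blk a b c| = 4.
Proof.
move=> u; have [dN _ _ _] := fP u.
have u4 : uniq [:: a; b; c; f a b c].
  by move: u dN; rewrite /= !inE !(eq_sym (f a b c)); lia.
rewrite -[4]/(size [:: a; b; c; f a b c]) -(card_uniqP u4).
by apply: eq_card => x; rewrite !inE -!orbA.
Qed.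

Lemma blk_closed a b c x y z : uniq [:: a; b; c] -> uniq [:: x; y; z] ->
  x \in blk a b c -> y \in blk a b c -> z \in blk a b c -> f x y z \in blk a b c.
Proof.
move=> u uz; have q : quad a b c (f a b c) by [].
rewrite /blk; move: (f a b c) q => d q.
have mem x' y' z' w : quad x' y' z' w -> w \in [set a; b; c; d] ->
  f x' y' z' \in [set a; b; c; d] by case=> _ ->.
move=> xb yb zb; rewrite !inE -!orbA in xb yb zb; move: uz.
case/or4P: xb => /eqP->; case/or4P: yb => /eqP->; case/or4P: zb => /eqP->;
  rewrite [uniq _]/= ?in_cons ?eqxx ?orbT ?andbF //= => _;
  (* The value of [f] is the remaining point of the block, found by trying all four. A permutation
     of four places is a product of at most six adjacent transpositions, which bounds the search
     depth. *)
  (apply: (@mem _ _ _ a); [by auto 7 | by rewrite !inE eqxx]) ||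
  (apply: (@mem _ _ _ b); [by auto 7 | by rewrite !inE eqxx ?orbT]) ||
  (apply: (@mem _ _ _ c); [by auto 7 | by rewrite !inE eqxx ?orbT]) ||
  (apply: (@mem _ _ _ d); [by auto 7 | by rewrite !inE eqxx ?orbT]).
Qed.

Lemma blkE a b c x y z : uniq [:: a; b; c] -> uniq [:: x; y; z] ->
  x \in blk a b c -> y \in blk a b c -> z \in blk a b c -> blk x y z = blk a b c.
Proof.
move=> u uz xb yb zb; apply/eqP; rewrite eqEcard !card_blk // andbT.
apply/subsetP=> w wb; rewrite !inE -!orbA in wb.
by case/or4P: wb => /eqP-> //; exact: blk_closed.
Qed.

Definition blocks : {set {set V}} :=
  [set blk t.1.1 t.1.2 t.2 | t in [set t : V * V * V | uniq [:: t.1.1; t.1.2; t.2]]].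

Lemma blocksP B : reflect (exists a b c, uniq [:: a; b; c] /\ B = blk a b c) (B \in blocks).
Proof.
apply: (iffP imsetP) => [[[[a b] c]]|[a [b [c [u ->]]]]].
  by rewrite inE => u ->; exists a, b, c.
by exists (a, b, c); rewrite ?inE.
Qed.

Lemma blocks_card B : B \in blocks -> #|B| = 4.
Proof. by case/blocksP=> a [b [c [u ->]]]; exact: card_blk. Qed.

Lemma blocks_triple (T : {set V}) : #|T| = 3 -> #|[set B in blocks | T \subset B]| = 1.
Proof.
move=> T3; have sT : size (enum T) = 3 by rewrite -cardE.
case eT : (enum T) sT => [|a [|b [|c [|]]]] // _.
have u : uniq [:: a; b; c] by rewrite -eT enum_uniq.
have inT x : (x \in T) = (x \in [:: a; b; c]) by rewrite -eT mem_enum.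
apply/eqP/cards1P; exists (blk a b c); apply/setP=> B; rewrite !inE.
apply/andP/eqP=> [[/blocksP[a' [b' [c' [u' ->]]]] /subsetP sTB]|->].
  by symmetry; apply: blkE => //; apply: sTB; rewrite inT !inE eqxx ?orbT.
split; first by apply/blocksP; exists a, b, c.
by apply/subsetP=> x; rewrite inT !inE => /or3P[] /eqP->; rewrite eqxx ?orbT.
Qed.

End SteinerOp.

(** * From cyclic quadruple systems to codes *)

Section Translation.

Variables (u v : nat).
Implicit Types (b : {set point u v}) (d : 'Z_v).

Lemma shift_pt_inj d : injective (@shift_pt u v d).
Proof. by move=> [i x] [j y] /eqP; rewrite xpair_eqE /= => /andP[/eqP-> /eqP/addIr->]. Qed.

Lemma shift_pt0 (x : point u v) : shift_pt 0%R x = x.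
Proof. by case: x => i x; rewrite /shift_pt /= addr0. Qed.

Lemma shift_ptD d e (x : point u v) : shift_pt e (shift_pt d x) = shift_pt (d + e)%R x.
Proof. by rewrite /shift_pt /= addrA. Qed.

Lemma shift_blk0 b : shift_blk 0%R b = b.
Proof. by rewrite /shift_blk (eq_imset _ shift_pt0) imset_id. Qed.

Lemma shift_blkD d e b : shift_blk e (shift_blk d b) = shift_blk (d + e)%R b.
Proof. by rewrite /shift_blk -imset_comp; apply: eq_imset => x; exact: shift_ptD. Qed.

Lemma mem_shift_blk d b x : (x \in shift_blk d b) = (shift_pt (- d)%R x \in b).
Proof.
rewrite -{1}[x]shift_pt0 -(addNr d) -shift_ptD mem_imset //.
exact: shift_pt_inj.
Qed.

Lemma card_shift_blk d b : #|shift_blk d b| = #|b|.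
Proof. by rewrite card_imset //; exact: shift_pt_inj. Qed.

Definition moment b : 'Z_v := (\sum_(x in b) x.2)%R.

Lemma moment_shift d b : moment (shift_blk d b) = (moment b + d *+ #|b|)%R.
Proof.
rewrite /moment /shift_blk big_imset /=; last by move=> x y _ _; exact: shift_pt_inj.
by rewrite big_split /= sumr_const.
Qed.

Hypotheses (v_gt1 : 1 < v) (v_odd : odd v).

Lemma Zp_mulrn4_eq0 d : (d *+ 4)%R = 0%R -> d = 0%R.
Proof.
case: v v_gt1 v_odd d => [|[|n]] // _ o d /(congr1 val).
rewrite Zp_mulrn /= => /eqP; rewrite -/(_ %| _) Gauss_dvdl; last first.
  by rewrite -[4]/(2 ^ 2) coprimeXr // coprimen2.
move=> dv; apply/val_inj => /=; move: (ltn_ord d) dv => /=.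
case: (nat_of_ord d) => // m lt_m /(dvdn_leq (ltn0Sn m)).
by rewrite leqNgt lt_m.
Qed.

Lemma shift_blk_neq d b : #|b| = 4 -> d != 0%R -> shift_blk d b != b.
Proof.
move=> b4; apply: contraNneq => /(congr1 moment).
by rewrite moment_shift b4 -[RHS]addr0 => /addrI/Zp_mulrn4_eq0->.
Qed.

Lemma Zp_4_surj d : exists e : 'Z_v, (e *+ 4)%R = d.
Proof.
have inj : injective (fun e : 'Z_v => e *+ 4)%R.
  by move=> x y /eqP; rewrite -subr_eq0 -mulrnBl => /eqP/Zp_mulrn4_eq0/subr0_eq.
by exists (invF inj d); rewrite (f_invF inj).
Qed.

Lemma steiner_op_SQS (f : point u v -> point u v -> point u v -> point u v) :
  steiner_op f ->
  (forall d x y z, f (shift_pt d x) (shift_pt d y) (shift_pt d z) = shift_pt d (f x y z)) ->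
  strictly_cyclic_SQS (blocks f).
Proof.
move=> fP fD; split; first exact: blocks_card.
- exact: blocks_triple.
- move=> b /blocksP[x [y [z [un ->]]]]; apply/blocksP.
  exists (shift_pt 1%R x), (shift_pt 1%R y), (shift_pt 1%R z); split.
    by rewrite -[[:: _; _; _]]/(map (shift_pt 1%R) [:: x; y; z]) map_inj_uniq //;
      exact: shift_pt_inj.
  by rewrite /blk /shift_blk fD !imsetU !imset_set1.
- by move=> b d /(blocks_card fP) b4; exact: shift_blk_neq.
Qed.

Section Code.

Variable B : {set {set point u v}}.
Hypothesis BP : strictly_cyclic_SQS B.

Let B4 b : b \in B -> #|b| = 4. Proof. by case: BP => ? _ _ _; auto. Qed.

Lemma SQS_shift d b : b \in B -> shift_blk d b \in B.
Proof.
move=> bB; have [_ _ B1 _] := BP.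
rewrite -[d]natr_Zp; elim: (nat_of_ord d) => [|n IHn]; first by rewrite shift_blk0.
by rewrite -natr1 -shift_blkD B1.
Qed.

Lemma SQS_capP b c : b \in B -> c \in B -> b != c -> #|b :&: c| <= 2.
Proof.
move=> bB cB; apply: contraR; rewrite -ltnNge => /card_geqP[s [us ss sbc]].
have T3 : #|[set x in s]| = 3 by rewrite cardsE (card_uniqP us).
have [_ /(_ _ T3) /eqP/cards1P[e He] _ _] := BP.
have sub e' : e' \in B -> {subset s <= e'} -> e' = e.
  move=> e'B se'; apply/set1P; rewrite -He inE e'B.
  by apply/subsetP=> x; rewrite inE => /se'.
have -> : b = e by apply: sub => // x /sbc; rewrite inE => /andP[].
by rewrite [c]sub // => x /sbc; rewrite inE => /andP[].
Qed.

(** Double counting of the pairs formed by a block and a triple inside it: each block contains four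
    triples, and each triple lies in one block. *)
Lemma SQS_size : #|B| * 4 = 'C(u * v, 3).
Proof.
have [_ B3 _ _] := BP.
have cV : #|{: point u v}| = u * v.
  by rewrite card_prod !card_ord; case: v v_gt1 => [|[|]].
rewrite -cV -card_draws -sum_nat_const -[RHS]sum1_card.
under eq_bigr => b /B4 b4.
  have -> : 4 = \sum_(T in [set T : {set point u v} | #|T| == 3] | T \subset b) 1.
    rewrite sum1_card -[4]/('C(4, 3)) -b4 -cards_draws.
    by apply: eq_card => T; rewrite [RHS]unfold_in !inE andbC.
  over.
rewrite (exchange_big_dep (mem [set T : {set point u v} | #|T| == 3])) /=; last first.
  by move=> b T _ /andP[].
apply: eq_bigr => T; rewrite inE => /eqP T3.
rewrite sum1_card -[RHS](B3 _ T3); apply: eq_card => b.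
by rewrite [LHS]unfold_in !inE T3 eqxx.
Qed.

Definition base_blocks : {set {set point u v}} := [set b in B | moment b == 0%R].

(** All [v] fibres of [moment] on [B] have the same size: if [4 d = m], translation by [d] carries
    the fibre over 0 onto the fibre over [m]. *)
Lemma card_base_blocks : #|B| = #|base_blocks| * v.
Proof.
have cv : #|'Z_v| = v by rewrite card_ord; case: v v_gt1 => [|[|]].
rewrite -sum1_card (partition_big (@moment) predT) //= mulnC.
rewrite -[X in _ = X * _]cv -sum_nat_const.
apply: eq_bigr => m _; have [d Ed] := Zp_4_surj m.
have shK : cancel (@shift_blk u v d) (shift_blk (- d)%R).
  by move=> b; rewrite shift_blkD subrr shift_blk0.
rewrite sum1_card -(card_imset (mem base_blocks) (can_inj shK)).
apply: eq_card => b; rewrite unfold_in /=.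
apply/andP/imsetP=> [[bB /eqP mb]|[c]].
  exists (shift_blk (- d)%R b); last by rewrite shift_blkD addNr shift_blk0.
  by rewrite inE SQS_shift // moment_shift B4 // mb -Ed mulNrn subrr.
rewrite inE => /andP[cB /eqP mc] ->.
by rewrite SQS_shift // moment_shift B4 // mc add0r Ed.
Qed.

Lemma base_blocks_shift b c d : b \in base_blocks -> c \in base_blocks ->
  shift_blk d b = c -> d = 0%R.
Proof.
rewrite !inE => /andP[bB /eqP mb] /andP[_ /eqP mc] /(congr1 moment).
by rewrite moment_shift mb mc add0r B4 //; exact: Zp_mulrn4_eq0.
Qed.

End Code.

End Translation.

(** The codewords are the indicator matrices of the base blocks. A correlation is the number of
    points common to a translate of one block and another block, and distinct blocks of [B] share at
    most two points. *)
Lemma SQS_OOC u v (B : {set {set point u v}}) : 1 < v -> odd v ->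
  strictly_cyclic_SQS B -> exists C : {set 'M[bool]_(u, v)}, perfect_OOC_2D C.
Proof.
(* For [v] of the form [n.+2] the types ['Z_v] and ['I_v] are convertible, so points can index
   matrix entries. *)
case: v B => [|[|n]] // B v1 vo BP; set v := n.+2 in v1 vo B BP *.
pose mat (b : {set point u v}) : 'M[bool]_(u, v) := (\matrix_(i, j) ((i, j) \in b))%R.
have matE b i (j : 'I_v) : mat b i j = ((i, j) \in b) by rewrite mxE.
have mat_inj : injective mat.
  by move=> b c /matrixP e; apply/setP=> [[i j]]; have := e i j; rewrite !matE.
have [B4 _ _ _] := BP.
exists (mat @: @base_blocks u v B); split; last first.
  rewrite card_imset //.
  (* The factor 6 turns the binomial coefficient into [u v (u v - 1) (u v - 2)]; cancelling [v]
     leaves 24 times the number of base blocks. *)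
  have := @SQS_size u v v1 B BP; rewrite (@card_base_blocks u v v1 vo B BP) => /(congr1 (muln 6)).
  have -> : 6 * 'C(u * v, 3) = (u * v) * (u * v - 1) * (u * v - 2).
    have := bin_ffact (u * v) 3; rewrite mulnC -[3`!]/6 => ->.
    by rewrite /falling_factorial /= !(subn1, muln1) mulnA; congr (_ * _); lia.
  move=> e; suff -> : u * (u * v - 1) * (u * v - 2) = #|@base_blocks u v B| * 24.
    by rewrite mulnK.
  apply/eqP; rewrite -(eqn_pmul2r (m := v)) //; apply/eqP.
  by move: e; nia.
split=> [A /imsetP[b]|A A' r /imsetP[b bC ->] /imsetP[c cC ->] neq].
  rewrite inE => /andP[/B4 b4 _] ->.
  rewrite /weight -b4 -sum1_card pair_big /= [RHS]big_mkcond /=.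
  by apply: eq_bigr => [[i j]] _; rewrite matE; case: ifP.
pose d : 'Z_v := inZp r.
have dn : @shift_blk u v d b != c.
  apply/eqP=> e; have d0 := @base_blocks_shift u v v1 vo B BP b c d bC cC e.
  move: neq; rewrite -e d0 shift_blk0 eqxx /=.
  by have := congr1 val d0 => /= ->.
have bB : b \in B by move: bC; rewrite inE => /andP[].
have cB : c \in B by move: cC; rewrite inE => /andP[].
apply: leq_trans (@SQS_capP u v B BP _ _ (@SQS_shift u v B BP d b bB) cB dn).
(* The correlation is indexed by the points of [b], so the intersection with [c] is moved back by
   [- d]; for each [(i, j)] only the column [k0 = j + d] can contribute. *)
rewrite -(card_imset _ (@shift_pt_inj u v (- d)%R)) -sum1_card.
rewrite big_mkcond /= /corr pair_big /=.
apply: leq_sum => [[i j]] _ /=.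
pose k0 : 'I_v := (j + d)%R.
rewrite (bigD1 k0) //= big1 ?addn0 => [|k kk]; last first.
  case: eqP; rewrite ?andbF // => ek; case/negP: kk.
  by apply/eqP/val_inj => /=; rewrite ek modnDmr.
rewrite !matE; case: and3P => // -[jb kc _].
rewrite ifT //; apply/imsetP; exists (i, k0); last first.
  by rewrite /shift_pt /= addrK.
rewrite inE kc andbT mem_shift_blk /shift_pt /= addrK.
by [].
Qed.

(** * Operations on two levels *)

Section TwoLevels.

Local Open Scope ring_scope.

Variables (F : zmodType) (h k : F -> F -> F -> F + F).

Definition shift_sum (d : F) (x : F + F) : F + F :=
  match x with inl y => inl (y + d) | inr y => inr (y + d) end.

(* [h a b c] completes {a,b,c} x {0} and [k a b w] completes {a,b} x {0}, (w,1); [inl] stays on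
   level 0 and [inr] is on level 1.  Level 1 is the image of level 0 under
   (i, x) |-> (1 - i, - x), which is why negations occur in [two_levels_k]. *)
Record two_levels : Prop := TwoLevels {
  two_levels_hC : forall a b c, uniq [:: a; b; c] -> h b a c = h a b c;
  two_levels_hCA : forall a b c, uniq [:: a; b; c] -> h a c b = h a b c;
  two_levels_kC : forall a b w, a != b -> k b a w = k a b w;
  two_levels_h : forall a b c, uniq [:: a; b; c] ->
    match h a b c with
    | inl d => d \notin [:: a; b; c] /\ h a b d = inl c
    | inr w => k a b w = inl c
    end;
  two_levels_k : forall a b w, a != b ->
    match k a b w with
    | inl c => [/\ c \notin [:: a; b], h a b c = inr w & k a c w = inl b]
    | inr w' => [/\ w' != w, k a b w' = inr w & k (- w) (- w') (- a) = inr (- b)]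
    end;
  two_levels_hD : forall d a b c, h (a + d) (b + d) (c + d) = shift_sum d (h a b c);
  two_levels_kD : forall d a b w, k (a + d) (b + d) (w + d) = shift_sum d (k a b w)
}.

Hypothesis hkP : two_levels.

Definition flip (i : bool) (x : F) := if i then - x else x.

(** The coordinate is restored by the flip of the level [i] at which [h] or [k] was evaluated, even
    when the resulting point lies on the other level. *)
Definition level_out (i : bool) (x : F + F) : bool * F :=
  match x with inl y => (i, flip i y) | inr y => (~~ i, flip i y) end.

Definition same_level i a b c := level_out i (h (flip i a) (flip i b) (flip i c)).
Definition mixed_level i a b w := level_out i (k (flip i a) (flip i b) (flip i w)).

Definition level_op (x y z : bool * F) : bool * F :=
  if x.1 == y.1 then
    if x.1 == z.1 then same_level x.1 x.2 y.2 z.2 else mixed_level x.1 x.2 y.2 z.2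
  else if x.1 == z.1 then mixed_level x.1 x.2 z.2 y.2
  else mixed_level y.1 y.2 z.2 x.2.

Let flipK i : involutive (flip i).
Proof. by case: i => x //=; rewrite opprK. Qed.

Let flip_inj i : injective (flip i). Proof. exact: inv_inj (flipK i). Qed.

Let flipNC i x : flip (~~ i) x = - flip i x.
Proof. by case: i => /=; rewrite ?opprK. Qed.

Let flipN i x : flip i (- x) = - flip i x.
Proof. by case: i. Qed.

Let uniq3 i a b c : uniq [:: a; b; c] -> uniq [:: flip i a; flip i b; flip i c].
Proof. by rewrite -(map_inj_uniq (@flip_inj i)). Qed.

Let same_levelC i a b c : uniq [:: a; b; c] -> same_level i b a c = same_level i a b c.
Proof. by move=> u; rewrite /same_level (two_levels_hC hkP) //; exact: uniq3. Qed.

Let same_levelCA i a b c : uniq [:: a; b; c] -> same_level i a c b = same_level i a b c.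
Proof. by move=> u; rewrite /same_level (two_levels_hCA hkP) //; exact: uniq3. Qed.

Let mixed_levelC i a b w : a != b -> mixed_level i b a w = mixed_level i a b w.
Proof. by move=> u; rewrite /mixed_level (two_levels_kC hkP) // (inj_eq (@flip_inj i)). Qed.

Let same_levelP i a b c : uniq [:: a; b; c] ->
  (exists d, [/\ same_level i a b c = (i, d), d \notin [:: a; b; c]
    & same_level i a b d = (i, c)]) \/
  (exists w, same_level i a b c = (~~ i, w) /\ mixed_level i a b w = (i, c)).
Proof.
move=> u; have := two_levels_h hkP (uniq3 i u); rewrite /same_level /mixed_level.
case: (h _ _ _) => [d [dN hd]|w kw]; [left; exists (flip i d)|right; exists (flip i w)].
  split=> //; last by rewrite flipK hd /= flipK.
  by move: dN; rewrite -(mem_map (@flip_inj i)) /= !flipK.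
by split=> //; rewrite flipK kw /= flipK.
Qed.

Let mixed_levelP i a b w : a != b ->
  (exists c, [/\ mixed_level i a b w = (i, c), c \notin [:: a; b],
    same_level i a b c = (~~ i, w) & mixed_level i a c w = (i, b)]) \/
  (exists w', [/\ mixed_level i a b w = (~~ i, w'), w' != w,
    mixed_level i a b w' = (~~ i, w) & mixed_level (~~ i) w w' a = (i, b)]).
Proof.
rewrite -(inj_eq (@flip_inj i)) => u.
have := two_levels_k hkP (flip i w) u; rewrite /same_level /mixed_level.
case: (k _ _ _) => [c [cN hc kc]|w' [w'N kw' kN]];
  [left; exists (flip i c)|right; exists (flip i w')].
  split=> //; rewrite ?flipK ?hc ?kc /= ?flipK //.
  by move: cN; rewrite -(mem_map (@flip_inj i)) /= !flipK.
split=> //; rewrite ?flipK ?kw' /= ?flipK //.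
  by rewrite -(inj_eq (@flip_inj i)) flipK.
by rewrite !flipNC flipK kN /= negbK flipNC flipN opprK flipK.
Qed.

Lemma level_opP : steiner_op level_op.
Proof.
move=> [i a] [j b] [l c]; rewrite /= !inE !xpair_eqE andbT negb_or => /andP[/andP[]].
have nN m : (m == ~~ m) = false by case: m.
have Nn m : (~~ m == m) = false by case: m.
have [<-{j}|/negbTE ij] := eqVneq i j; have [<-{l}|/negbTE il] := eqVneq i l => /=.
- move=> ab ac bc.
  have u : uniq [:: a; b; c] by rewrite /= !inE negb_or ab ac bc.
  rewrite /level_op /= eqxx /= (same_levelC i u) (same_levelCA i u).
  case: (same_levelP i u) => [[d [-> dN sd]]|[w [-> kw]]]; rewrite !xpair_eqE /=.
    by rewrite eqxx; rewrite !inE in dN.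
  by rewrite ?Nn ?nN.
- have -> : l = ~~ i by case: (i) (l) il => -[].
  move=> ab _ _; rewrite /level_op /= eqxx ?nN ?Nn /= (@mixed_levelC i a b) //.
  case: (mixed_levelP i c ab) => [[d [-> dN sd md]]|[w' [-> w'N kw' mw]]];
    rewrite !xpair_eqE /=.
    by rewrite ?eqxx ?nN orbF; rewrite !inE in dN.
  by rewrite ?Nn ?nN ?eqxx.
- have -> : j = ~~ i by case: (i) (j) ij => -[].
  move=> _ ac _; rewrite /level_op /= eqxx ?nN ?Nn /=.
  case: (mixed_levelP i b ac) => [[d [-> dN sd md]]|[w' [-> w'N kw' mw]]];
    rewrite !xpair_eqE /=.
    by rewrite ?eqxx ?nN /=; rewrite !inE in dN.
  by rewrite ?Nn ?nN ?eqxx /= orbF.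
- have -> : l = ~~ i by case: (i) (l) il => -[].
  have -> : j = ~~ i by case: (i) (j) ij => -[].
  rewrite eqxx /= => _ _ bc.
  rewrite /level_op /= eqxx ?nN ?Nn /= (@mixed_levelC (~~ i) b c) //.
  case: (mixed_levelP (~~ i) a bc) => [[d [-> dN sd md]]|[w' [-> w'N kw' mw]]];
    rewrite !xpair_eqE /= ?negbK.
    by rewrite ?nN ?Nn ?eqxx /=; rewrite !inE in dN.
  rewrite negbK in mw.
  by rewrite ?eqxx ?nN /= orbF.
Qed.

Lemma level_opD d x y z :
  level_op (x.1, x.2 + d) (y.1, y.2 + d) (z.1, z.2 + d) =
  ((level_op x y z).1, (level_op x y z).2 + d).
Proof.
have flipD i e : flip i (e + d) = flip i e + flip i d by case: i => //=; rewrite opprD.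
have out i r : level_out i (shift_sum (flip i d) r) =
    ((level_out i r).1, (level_out i r).2 + d).
  by case: r => r; case: i => //=; rewrite opprD opprK.
have same i a b c : same_level i (a + d) (b + d) (c + d) =
    ((same_level i a b c).1, (same_level i a b c).2 + d).
  by rewrite /same_level !flipD (two_levels_hD hkP) out.
have mixed i a b c : mixed_level i (a + d) (b + d) (c + d) =
    ((mixed_level i a b c).1, (mixed_level i a b c).2 + d).
  by rewrite /mixed_level !flipD (two_levels_kD hkP) out.
by rewrite /level_op /=; case: ifP => _; case: ifP => _; rewrite ?same ?mixed.
Qed.

End TwoLevels.

Lemma two_levels_exist p (h k : 'Z_p -> 'Z_p -> 'Z_p -> 'Z_p + 'Z_p) : 1 < p -> odd p ->
  two_levels h k ->
  (exists B : {set {set point 2 p}}, strictly_cyclic_SQS B) /\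
  (exists C : {set 'M[bool]_(2, p)}, perfect_OOC_2D C).
Proof.
move=> p1 po hkP.
suff [B BP] : exists B : {set {set point 2 p}}, strictly_cyclic_SQS B.
  by split; [exists B | exact: SQS_OOC p1 po BP].
pose enc (x : point 2 p) : bool * 'Z_p := (x.1 != ord0, x.2).
pose dec (x : bool * 'Z_p) : point 2 p := (inord x.1, x.2).
have encK : cancel enc dec.
  move=> [i x]; rewrite /enc /dec /=; congr (_, _); apply/val_inj.
  by case: i => -[|[|]] //= ?; rewrite inordK.
have decK : cancel dec enc.
  move=> [i x]; rewrite /enc /dec /=; congr (_, _).
  by rewrite -val_eqE /= inordK; case: i.
pose f x y z := dec (level_op h k (enc x) (enc y) (enc z)).
exists (blocks f); apply: steiner_op_SQS => //.
  move=> x y z; rewrite -(map_inj_uniq (can_inj encK)) => u.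
  have [dN fC fCA fK] := level_opP hkP u; rewrite /f decK fC fCA fK encK; split=> //.
  by rewrite -(mem_map (can_inj encK)) decK.
move=> d x y z; rewrite /f /shift_pt.
by rewrite -[in RHS]/(dec _); have := level_opD hkP d (enc x) (enc y) (enc z) => /= ->.
Qed.

(** * Parallelograms *)

Section MidpointDesign.

Local Open Scope ring_scope.

Variable F : fieldType.
Hypotheses (two_neq0 : 2%:R != 0 :> F) (three_neq0 : 3%:R != 0 :> F).

Definition mid (a b c : F) := a + b == c + c.

(** [tab s t] selects the parallelograms with diagonals [s] and [t], given as differences up to
    order and sign. The three terms of [tab1] are the parallelograms through 0, b, c: exactly one is
    selected, or none if the triple is a progression. *)
Variable tab : F -> F -> bool.
Hypothesis tabC : forall s t, tab s t = tab t s.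
Hypothesis tabN : forall s t, tab (- s) t = tab s t.
Hypothesis tab1 : forall b c, uniq [:: 0; b; c] ->
  (tab b (c + c - b) + tab c (b + b - c) + tab (b - c) (b + c) =
   [&& ~~ mid 0 b c, ~~ mid 0 c b & ~~ mid b c 0])%N.

Definition sel (a b c : F) := tab (a - b) (c + c - (a + b)).

(** On distinct triples the final branch is the third selection: a triple that is not a progression
    has exactly one selected parallelogram. *)
Definition mid_h (a b c : F) : F + F :=
  if mid a b c then inr c else if mid b c a then inr a else if mid a c b then inr b else
  if sel a b c then inl (a + b - c) else if sel b c a then inl (b + c - a)
  else inl (a + c - b).

Definition mid_k (a b w : F) : F + F :=
  if mid a b w then inl w else if w == a then inl (a + a - b)
  else if w == b then inl (b + b - a) else inr (a + b - w).

Let midC a b c : mid b a c = mid a b c. Proof. by rewrite /mid addrC. Qed.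

Let midD d a b c : mid (a + d) (b + d) (c + d) = mid a b c.
Proof.
rewrite /mid -subr_eq0 -[RHS]subr_eq0.
by have -> : a + d + (b + d) - (c + d + (c + d)) = a + b - (c + c) by ring.
Qed.

Let tabNr s t : tab s (- t) = tab s t. Proof. by rewrite tabC tabN tabC. Qed.

Let selC a b c : sel b a c = sel a b c.
Proof. by rewrite /sel -tabN opprB [b + a]addrC. Qed.

Let selD d a b c : sel (a + d) (b + d) (c + d) = sel a b c.
Proof. by rewrite /sel; congr tab; ring. Qed.

Let dbl_inj (x y : F) : x + x = y + y -> x = y.
Proof. by move=> e; apply: (mulfI two_neq0); rewrite !mulr_natl !mulr2n. Qed.

(** Subtracting the two midpoint equations gives [3 (a - c) = 0]. Hence a progression of distinct
    points has only one midpoint. *)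
Let mid_excl a b c : mid a b c -> mid b c a -> a = c.
Proof.
move=> /eqP e1 /eqP e2; apply: (mulfI three_neq0); apply/eqP.
rewrite -subr_eq0 -mulrBr.
have -> : 3%:R * (a - c) = (a + b - (c + c)) - (b + c - (a + a)) by ring.
by rewrite e1 e2 !subrr.
Qed.

Let midN (a b c : F) : uniq [:: a; b; c] -> mid a b c ->
  (mid b c a = false) * (mid a c b = false).
Proof.
rewrite /= !inE negb_or andbT => /andP[/andP[ab ac] bc] m.
split; apply/negP => m'.
  by move: ac; rewrite (mid_excl m m') eqxx.
by rewrite -midC in m; move: bc; rewrite (mid_excl m m') eqxx.
Qed.

Let h_mid (a b c : F) : uniq [:: a; b; c] -> mid a b c ->
  [/\ mid_h a b c = inr c, mid_h b a c = inr c & mid_h a c b = inr c] /\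
  [/\ mid_h b c a = inr c, mid_h c a b = inr c & mid_h c b a = inr c].
Proof.
move=> u m; have [m1 m2] := midN u m.
by rewrite /mid_h !(midC a b) !(midC b c) !(midC a c) m m1 m2.
Qed.

Definition apfree (a b c : F) := [&& ~~ mid a b c, ~~ mid b c a & ~~ mid a c b].

(** This is [tab1] translated so that 0 becomes [a]; the symmetries of [tab] absorb the signs. *)
Let sel1 (a b c : F) : uniq [:: a; b; c] ->
  (sel a b c + sel b c a + sel a c b = apfree a b c)%N.
Proof.
move=> u; have := @tab1 (b - a) (c - a).
have -> : c - a + (c - a) - (b - a) = c + c - (a + b) by ring.
have -> : b - a + (b - a) - (c - a) = b + b - (a + c) by ring.
have -> : b - a - (c - a) = b - c by ring.
have -> : b - a + (c - a) = - (a + a - (b + c)) by ring.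
have -> : mid 0 (b - a) (c - a) = mid a b c by rewrite -(midD a) add0r !subrK.
have -> : mid 0 (c - a) (b - a) = mid a c b by rewrite -(midD a) add0r !subrK.
have -> : mid (b - a) (c - a) 0 = mid b c a by rewrite -(midD a) add0r !subrK.
rewrite -[b - a]opprB -[c - a]opprB !tabN tabNr addnAC !opprB => e.
rewrite /apfree [~~ mid b c a && _]andbC -e //.
by move: u; rewrite -(map_inj_uniq (addIr (- a))) /= subrr.
Qed.

Let selP (a b c : F) : uniq [:: a; b; c] -> sel a b c -> apfree a b c.
Proof. by move=> u s; have := sel1 u; rewrite s; case: apfree. Qed.

Let h_sel (a b c : F) : uniq [:: a; b; c] -> sel a b c ->
  [/\ mid_h a b c = inl (a + b - c), mid_h b a c = inl (a + b - c)
    & mid_h a c b = inl (a + b - c)] /\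
  [/\ mid_h b c a = inl (a + b - c), mid_h c a b = inl (a + b - c)
    & mid_h c b a = inl (a + b - c)].
Proof.
move=> u s; have := sel1 u; rewrite s (selP u s).
case/and3P: (selP u s) => /negbTE m1 /negbTE m2 /negbTE m3.
case s2 : (sel b c a); case s3 : (sel a c b) => // _.
by rewrite /mid_h !(midC a b) !(midC b c) !(midC a c) m1 m2 m3 !(selC a b) !(selC b c)
  !(selC a c) s s2 s3 [b + a]addrC.
Qed.

Let perm3 (a b c : F) : uniq [:: a; b; c] -> uniq [:: b; c; a] /\ uniq [:: a; c; b].
Proof.
by move=> u; split; rewrite -(perm_uniq (s1 := [:: a; b; c])) //; apply/permP=> x /=; lia.
Qed.

(** Normal form: some arrangement of the triple has as its first two entries the ends of a
    progression or a diagonal of the selected parallelogram. *)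
Let h_cases (a b c : F) (P : F -> F -> F -> Prop) : uniq [:: a; b; c] ->
  (forall x y z, uniq [:: x; y; z] -> mid x y z \/ sel x y z -> P x y z) ->
  [\/ P a b c, P b c a | P a c b].
Proof.
move=> u PP; have [u2 u3] := perm3 u; have := sel1 u; rewrite /apfree.
case m1: (mid a b c); first by constructor 1; auto.
case m2: (mid b c a); first by constructor 2; auto.
case m3: (mid a c b); first by constructor 3; auto.
case s1: (sel a b c); first by constructor 1; auto.
case s2: (sel b c a); first by constructor 2; auto.
by case s3: (sel a c b) => // _; constructor 3; auto.
Qed.

Let h_perm (a b c : F) : uniq [:: a; b; c] -> exists r,
  [/\ mid_h a b c = r, mid_h b a c = r & mid_h a c b = r] /\
  [/\ mid_h b c a = r, mid_h c a b = r & mid_h c b a = r].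
Proof.
move=> u; pose P x y z := exists r,
  [/\ mid_h x y z = r, mid_h y x z = r & mid_h x z y = r] /\
  [/\ mid_h y z x = r, mid_h z x y = r & mid_h z y x = r].
have [] := @h_cases a b c P u.
- by move=> x y z ux [m|s]; [exists (inr z); exact: h_mid | exists (inl (x + y - z)); exact: h_sel].
- by [].
- by case=> r [[? ? ?] [? ? ?]]; exists r.
- by case=> r [[? ? ?] [? ? ?]]; exists r.
Qed.

(* The parallelogram x + y = z + d contains each of its triples in a selected position. *)
Let sel_block (x y z : F) : uniq [:: x; y; z] -> sel x y z -> let d := x + y - z in
  [/\ d \notin [:: x; y; z], uniq [:: x; y; d], sel x y d, uniq [:: z; d; x] & sel z d x].
Proof.
move=> u s d; case/and3P: (selP u s) => m _ _.
move: u; rewrite /= !inE negb_or andbT => /andP[/andP[xy xz] yz].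
have dx : d != x by rewrite -subr_eq0 (_ : d - x = y - z) ?subr_eq0 // /d; ring.
have dy : d != y by rewrite -subr_eq0 (_ : d - y = x - z) ?subr_eq0 // /d; ring.
have dz : d != z by rewrite -subr_eq0 (_ : d - z = x + y - (z + z)) ?subr_eq0 // /d; ring.
split.
- by rewrite !negb_or dx dy dz.
- by rewrite !(eq_sym _ d) negb_or xy dx dy.
- rewrite /sel (_ : d + d - _ = - (z + z - (x + y))) ?tabNr //.
  by rewrite /d; ring.
- by rewrite negb_or eq_sym dz eq_sym xz dx.
rewrite /sel tabC -tabNr.
have -> : x + x - (z + d) = x - y by rewrite /d; ring.
by have -> : - (z - d) = - (z + z - (x + y)); [rewrite /d; ring | rewrite tabNr].
Qed.

Lemma midpoint_two_levels : two_levels mid_h mid_k.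
Proof.
split.
- by move=> a b c /h_perm[r [[-> -> _] _]].
- by move=> a b c /h_perm[r [[-> _ ->] _]].
- move=> a b w ab; rewrite /mid_k midC [b + a]addrC.
  case: ifP => // _; have [->|wb] := eqVneq w b; last by [].
  by rewrite [b == a]eq_sym (negbTE ab).
- move=> a b c u.
  have [] := @h_cases a b c (fun x y z => (mid x y z \/ sel x y z) /\ uniq [:: x; y; z]) u.
  + by [].
  + case=> -[m|s] _.
      have [[-> _ _] _] := h_mid u m.
      by rewrite /mid_k m.
    have [[-> _ _] _] := h_sel u s; have [dN ud sd _ _] := sel_block u s.
    have [[-> _ _] _] := h_sel ud sd; split=> //; congr inl; ring.
  + case=> -[m|s] u'.
      have [_ [_ -> _]] := h_mid u' m; rewrite /mid_k.
      move: (u) m; rewrite /mid (inj_eq (addrI a)) eqxx /= !inE negb_or eq_sym.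
      by case/andP=> /andP[/negbTE-> _] _ /eqP<-; congr inl; ring.
    have [_ [_ -> _]] := h_sel u' s; have [dN _ _ ud sd] := sel_block u' s.
    have [[_ _ ->] _] := h_sel ud sd; split; last by congr inl; ring.
    by move: dN; rewrite !inE !negb_or => /and3P[-> -> ->].
  + case=> -[m|s] u'.
      have [[_ _ ->] _] := h_mid u' m; rewrite /mid_k.
      move: (u) m; rewrite /mid (inj_eq (addIr b)) eqxx /= !inE negb_or [b == a]eq_sym.
      by case/andP=> /andP[/negbTE-> _] _ /eqP<-; congr inl; ring.
    have [[_ _ ->] _] := h_sel u' s; have [dN _ _ ud sd] := sel_block u' s.
    have [_ [_ -> _]] := h_sel ud sd; split; last by congr inl; ring.
    by move: dN; rewrite !inE !negb_or => /and3P[-> -> ->].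
- move=> a b w ab; rewrite {1}/mid_k; case: ifP => [m|mw].
    have wa : w != a.
      by apply: contraNneq ab => wa; move: m; rewrite wa /mid (inj_eq (addrI a)) eq_sym.
    have wb : w != b.
      by apply: contraNneq ab => wb; move: m; rewrite wb /mid (inj_eq (addIr b)).
    have u : uniq [:: a; b; w] by rewrite /= !inE negb_or ab !(eq_sym _ w) wa wb.
    have [[-> _ _] _] := h_mid u m; split; rewrite ?inE ?negb_or ?wa //.
    rewrite /mid_k /mid (inj_eq (addIr w)) eq_sym (negbTE wa) eqxx.
    by move: m => /eqP <-; congr inl; ring.
  case: eqP => [->|/eqP wa]; last case: eqP => [->|/eqP wb].
  + set c := a + a - b; have m : mid b c a by apply/eqP; rewrite /c; ring.
    have ca : c != a by rewrite -subr_eq0 (_ : c - a = a - b) ?subr_eq0 // /c; ring.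
    have cb : c != b.
      apply: contra ab => /eqP cb; apply/eqP/dbl_inj.
      by move: cb; rewrite /c => /(congr1 (fun t => t + b)); rewrite subrK.
    have u : uniq [:: b; c; a] by rewrite /= !inE negb_or eq_sym cb eq_sym ab ca.
    have [_ [_ -> _]] := h_mid u m; split; rewrite ?inE ?negb_or ?ca //.
    rewrite /mid_k /mid (inj_eq (addrI a)) (negbTE ca) eqxx.
    by congr inl; rewrite /c; ring.
  + set c := b + b - a; have m : mid a c b by apply/eqP; rewrite /c; ring.
    have cb : c != b by rewrite -subr_eq0 (_ : c - b = b - a) ?subr_eq0 1?eq_sym // /c; ring.
    have ca : c != a.
      apply: contra ab => /eqP ca; apply/eqP/dbl_inj.
      by move: ca; rewrite /c => /(congr1 (fun t => t + a)); rewrite subrK.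
    have u : uniq [:: a; c; b] by rewrite /= !inE negb_or eq_sym ca ab cb.
    have [[_ _ ->] _] := h_mid u m; split; rewrite ?inE ?negb_or ?ca //.
    by rewrite /mid_k m.
  + have w'w : a + b - w != w.
      apply: contraFneq mw => e; apply/eqP; rewrite -{2}e; ring.
    have w'a : a + b - w != a.
      by rewrite -subr_eq0 (_ : _ - a = b - w) ?subr_eq0 1?eq_sym //; ring.
    have w'b : a + b - w != b.
      by rewrite -subr_eq0 (_ : _ - b = a - w) ?subr_eq0 1?eq_sym //; ring.
    split=> //; rewrite /mid_k.
      rewrite (negbTE w'a) (negbTE w'b) ifF; first by congr inr; ring.
      apply/negbTE; apply: contraFN mw => /eqP e; apply/eqP.
      by have -> : w + w = (a + b) + (a + b) - (a + b - w + (a + b - w)); [ring | rewrite -e; ring].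
    rewrite !(inj_eq (@oppr_inj _)) eq_sym (negbTE wa) [a == _]eq_sym (negbTE w'a) ifF.
      by congr inr; ring.
    (* The pair [- w], [- (a + b - w)] has sum [- (a + b)]; if [- a] were its midpoint, then
       [a = b]. *)
    apply/negbTE; apply: contraNN ab => /eqP e; apply/eqP.
    have -> : a = - (- a - a) - a by ring.
    by rewrite -e; ring.
- move=> d a b c; rewrite /mid_h !midD !selD.
  by do !case: ifP => _ //=; congr inl; ring.
- move=> d a b w; rewrite /mid_k midD !(inj_eq (addIr d)).
  by do !case: ifP => _ //=; congr inl || congr inr; ring.
Qed.

End MidpointDesign.

(** * Computable tables of selected parallelograms modulo p *)

Section Tables.

Local Open Scope N_scope.

Definition add_mod (p a b : N) : N := let c := N.add a b in if N.ltb c p then c else N.sub c p.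
Definition sub_mod (p a b : N) : N := if N.leb b a then N.sub a b else N.sub (N.add a p) b.
(** Canonical representative of a residue up to sign; it makes table lookup invariant under
    negation. *)
Definition abs_mod (p a : N) : N := N.min a (N.sub p a).

(** Injective for second entries below 512, which covers the residues of all the primes used;
    [PositiveSet] requires positive keys. *)
Definition key (s t : N) : positive := N.succ_pos (N.add (N.mul s 512) t).

Fixpoint add_orbit (p g : N) (n : nat) (s t : N) (T : PositiveSet.t) : PositiveSet.t :=
  if n is n'.+1 then
    add_orbit p g n' (N.modulo (N.mul g s) p) (N.modulo (N.mul g t) p)
      (PositiveSet.add (key (abs_mod p s) (abs_mod p t)) T)
  else T.

Definition orbit_table (p g : N) (n : nat) (base : seq (N * N)) : PositiveSet.t :=
  foldr (fun st T => add_orbit p g n st.1 st.2 T) PositiveSet.empty base.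

Definition in_table (p : N) (T : PositiveSet.t) (s t : N) : bool :=
  PositiveSet.mem (key (abs_mod p s) (abs_mod p t)) T
  || PositiveSet.mem (key (abs_mod p t) (abs_mod p s)) T.

(** Evaluates [tab1] at all distinct nonzero residues, so correctness rests on this check alone and
    not on how the table was found. *)
Definition check_table (p : N) (T : PositiveSet.t) : bool :=
  let r := [seq N.of_nat i | i <- iota 1 (N.to_nat p).-1] in
  all (fun b => all (fun c =>
    N.eqb b c ||
    (let b2 := add_mod p b b in let c2 := add_mod p c c in let bc := add_mod p b c in
     eqn (in_table p T b (sub_mod p c2 b) + in_table p T c (sub_mod p b2 c)
          + in_table p T (sub_mod p b c) bc)%N
         [&& ~~ N.eqb b c2, ~~ N.eqb c b2 & ~~ N.eqb bc 0])) r) r.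

End Tables.

(** * From a checked table to a design over the prime field *)

Section TableDesign.

Variables (p : nat) (p_pr : prime p).

Let natF (x : 'F_p) : N := N.of_nat x.

Let F_lt (x : 'F_p) : x < p.
Proof. by have := ltn_ord x; rewrite [X in _ < X](Fp_cast p_pr). Qed.

Let natF_inj : injective natF.
Proof. by move=> x y /Nnat.Nat2N.inj/val_inj. Qed.

Let natFD x y : natF (x + y)%R = add_mod (N.of_nat p) (natF x) (natF y).
Proof.
have -> : natF (x + y)%R = N.of_nat ((x + y) %% p).
  by rewrite /natF /= [X in _ %% X](Fp_cast p_pr).
rewrite /natF /add_mod; have := F_lt x; have := F_lt y.
move: (nat_of_ord x) (nat_of_ord y) => a b la lb.
case: N.ltb_spec => l; first by rewrite modn_small; lia.
have le : p <= a + b by lia.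
by rewrite -(subnK le) modnDr modn_small; lia.
Qed.

Let natFB x y : natF (x - y)%R = sub_mod (N.of_nat p) (natF x) (natF y).
Proof.
have -> : natF (x - y)%R = N.of_nat ((x + (p - y)) %% p).
  by rewrite /natF /= modnDmr [X in _ %% X](Fp_cast p_pr) [X in _ + (X - _)](Fp_cast p_pr).
rewrite /natF /sub_mod; have := F_lt x; have := F_lt y.
move: (nat_of_ord x) (nat_of_ord y) => a b la lb.
case: N.leb_spec => l; last by rewrite modn_small; lia.
have -> : a + (p - b) = a - b + p by lia.
by rewrite modnDr modn_small; lia.
Qed.

Let abs_modN (x : 'F_p) : abs_mod (N.of_nat p) (natF (- x)%R) = abs_mod (N.of_nat p) (natF x).
Proof.
rewrite -sub0r natFB (_ : natF 0%R = N0) // /sub_mod /abs_mod /natF; have := F_lt x.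
by move: (nat_of_ord x) => a; case: N.leb_spec; lia.
Qed.

Lemma table_design T : 3 < p -> odd p -> check_table (N.of_nat p) T ->
  (exists B : {set {set point 2 p}}, strictly_cyclic_SQS B) /\
  (exists C : {set 'M[bool]_(2, p)}, perfect_OOC_2D C).
Proof.
move=> p3 po chk.
pose tab (s t : 'F_p) := in_table (N.of_nat p) T (natF s) (natF t).
have neq0 m : 0 < m -> m < p -> (m%:R != 0 :> 'F_p)%R.
  move=> m0 mp; rewrite -(inj_eq val_inj) /= val_Fp_nat // modn_small //.
  by rewrite -lt0n.
have hk : two_levels (@mid_h _ tab) (@mid_k _).
  apply: midpoint_two_levels.
  - exact: (neq0 2 isT (ltnW p3)).
  - exact: (neq0 3 isT p3).
  - by move=> s t; rewrite /tab /in_table orbC.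
  - by move=> s t; rewrite /tab /in_table abs_modN.
  move=> b c; rewrite /= !inE negb_or andbT => /andP[/andP[b0 c0] bc].
  have rg (x : 'F_p) : (0%R != x) ->
      natF x \in [seq N.of_nat i | i <- iota 1 (N.to_nat (N.of_nat p)).-1].
    rewrite eq_sym -(inj_eq val_inj) /= -lt0n => x0.
    apply: map_f; rewrite Nnat.Nat2N.id mem_iota x0 /=.
    by have := F_lt x; lia.
  move/allP/(_ _ (rg _ b0))/allP/(_ _ (rg _ c0)): chk.
  case: N.eqb_spec => [/natF_inj e|_]; first by rewrite e eqxx in bc.
  rewrite /= -!natFD -!natFB => /eqnP; rewrite -!/(tab _ _) => ->.
  have eqbE (x y : 'F_p) : N.eqb (natF x) (natF y) = (x == y).
    by apply/idP/eqP => [/N.eqb_spec/natF_inj|->]; rewrite ?N.eqb_refl.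
  by rewrite -[N0]/(natF 0%R) !eqbE /mid !add0r.
(* ['F_p] is by definition ['Z_(pdiv p)], so the construction is instantiated at [pdiv p], which
   equals [p]. *)
have := @two_levels_exist (pdiv p) _ _ _ _ hk; rewrite pdiv_id //; apply=> //.
exact: prime_gt1.
Qed.

End TableDesign.

(* Each pair (s, t) stands for the parallelograms with diagonals g^i s and g^i t, i < n, where the
   multiplier g has order n; n is the largest divisor of p - 1 prime to 3, since a multiplier of
   order 3 would permute the three parallelograms on an equilateral triangle.  The pairs come
   from a computer search for a perfect matching. *)
Definition orbits37 : seq (N * N) :=
  [:: (2,4); (4,6); (6,16); (6,9); (3,6); (2,14); (2,10); (6,11); (9,16); (1,2); (2,8); (7,17);
     (2,11); (4,17); (2,9); (2,7); (2,5); (2,3); (8,18); (9,18); (8,14); (10,18); (3,8); (4,7)]%num.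

Definition orbits61 : seq (N * N) :=
  [:: (2,4); (8,28); (2,16); (2,8); (4,11); (3,4); (2,3); (4,23); (2,14); (4,10); (1,2); (2,10);
     (2,12); (2,26)]%num.

Definition orbits73 : seq (N * N) :=
  [:: (2,4); (4,6); (6,22); (8,21); (5,24); (10,11); (6,26); (6,14); (6,25); (5,10); (2,17);
     (10,32); (12,17); (2,22); (2,18); (4,25); (4,33); (1,2); (8,30); (4,8); (2,16); (2,20);
     (2,24); (2,26); (2,28); (6,34); (2,33); (2,35); (12,21); (2,15); (2,11); (2,7); (2,5);
     (2,3); (5,8); (6,7); (4,30); (4,17); (4,7); (18,24); (12,25); (6,36); (4,32); (18,21);
     (4,21); (5,12); (23,24); (5,6); (9,18); (12,24); (6,17)]%num.

Definition orbits109 : seq (N * N) :=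
  [:: (2,4); (4,6); (6,8); (8,10); (10,12); (12,14); (14,16); (16,18); (6,49); (6,37); (22,24);
     (14,29); (1,53); (33,38); (28,30); (30,32); (1,44); (22,44); (21,22); (1,30); (12,31);
     (1,24); (2,41); (1,18); (8,51); (1,12); (1,10); (1,8); (1,6); (1,4); (1,2); (2,8); (2,10);
     (2,12); (2,14); (2,16); (2,18); (2,20); (2,22); (2,24); (12,16); (2,28); (27,50); (2,34);
     (2,38); (2,40); (2,42); (2,44); (2,46); (2,48); (24,28); (2,52); (2,53); (28,32); (32,36);
     (21,44); (2,35); (2,31); (2,21); (2,27); (2,23); (2,19); (2,17); (8,15); (2,13); (2,9);
     (15,38); (2,5); (4,10); (6,12); (8,14); (10,19); (10,24); (6,26); (10,44); (10,21);
     (27,47); (10,41); (4,24); (10,48); (5,10); (10,28); (28,34); (10,51); (32,38); (10,54);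
     (10,32); (9,10); (10,52); (41,47); (10,37); (41,48); (10,40); (3,8); (3,6); (28,48);
     (4,14); (4,18); (4,20); (4,22); (27,36); (4,28); (7,39); (4,32); (4,36); (4,40); (4,42);
     (4,44); (24,39); (22,30); (4,52); (4,49); (30,38); (4,41); (36,44); (22,41); (4,29);
     (4,21); (4,17); (4,15); (4,13); (4,9); (4,7); (15,48); (6,16); (39,53); (12,22); (14,17);
     (6,9); (18,53); (24,34); (28,53); (19,22); (9,12); (42,45); (32,35); (22,25); (12,15);
     (45,48); (5,16); (15,18); (13,27); (6,24); (6,30); (6,34); (6,36); (6,38); (6,42); (27,42);
     (6,48); (6,50); (6,54); (6,47); (6,39); (6,35); (25,44); (6,31); (6,27); (21,48); (6,19);
     (6,15); (6,11); (6,7); (12,26); (13,44); (13,22); (13,18); (13,48); (24,38); (21,47);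
     (7,48); (8,13); (32,51); (7,32); (22,48); (28,54); (12,38); (7,18); (8,26); (19,36);
     (8,36); (16,32); (8,42); (8,44); (8,50); (8,52); (14,31); (8,9); (8,37); (8,29); (8,27);
     (21,38); (8,21); (8,17); (16,34); (30,41); (30,48); (12,37); (14,35); (27,45); (32,50);
     (9,24); (9,16); (14,36); (36,45); (16,38); (16,21); (12,49); (15,22); (11,22); (12,25);
     (11,16); (14,38); (16,45); (12,47); (12,41); (12,27); (12,21); (14,44); (16,41); (24,52);
     (14,45); (19,38); (25,32); (22,35); (16,25); (18,27); (19,28); (16,51); (16,37); (16,35);
     (32,45); (38,39); (24,35)]%num.

Definition orbits157 : seq (N * N) :=
  [:: (2,4); (2,18); (2,22); (2,26); (2,30); (2,34); (2,38); (2,42); (2,46); (2,69); (2,65);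
     (2,66); (2,70); (2,74); (2,8); (2,5); (2,63); (2,32); (2,60); (2,47); (2,57); (2,61);
     (6,71); (2,11); (2,28); (18,36); (6,53); (2,48); (2,12); (2,36); (2,24); (6,12); (6,66);
     (6,31); (18,62); (6,68); (18,37); (6,24)]%num.

Definition orbits181 : seq (N * N) :=
  [:: (2,4); (4,6); (4,56); (18,35); (6,83); (22,81); (4,73); (4,65); (10,87); (10,74); (4,31);
     (4,42); (14,56); (10,46); (6,78); (14,31); (6,68); (6,56); (2,42); (6,19); (2,40); (2,36);
     (22,28); (4,66); (4,80); (10,79); (6,59); (2,56); (6,22); (10,60); (4,19); (4,85); (4,22);
     (2,72); (2,68); (4,40); (4,48); (2,74); (2,86); (2,19); (4,34); (14,77); (6,50); (2,67);
     (2,71); (4,29); (4,37); (2,8); (2,10); (6,47); (6,10); (4,39); (10,14); (2,28); (2,30);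
     (2,32); (10,78); (2,44); (25,28); (2,54); (2,58); (2,62); (2,66); (4,61); (2,84); (2,88);
     (2,89); (7,10); (10,51); (4,7); (2,75); (14,27); (2,57); (2,53); (2,51); (2,15); (2,47);
     (2,41); (2,37); (2,29); (2,27); (2,25); (2,23); (2,21); (2,17); (2,13); (4,10); (6,12);
     (6,80); (4,90); (4,36); (4,11); (18,24); (6,65); (4,68); (6,77); (4,26); (4,18); (4,57);
     (4,49); (4,14); (4,77); (6,73); (14,15); (14,81); (10,18); (4,87); (4,79); (6,16); (10,20);
     (6,26); (6,28); (6,54); (6,45); (6,58); (10,27); (6,48); (10,37); (6,17); (6,53); (30,48);
     (14,28); (10,64); (10,40); (18,36); (10,90); (30,51); (18,90); (10,21); (14,34); (14,21);
     (14,50)]%num.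

Definition orbits229 : seq (N * N) :=
  [:: (2,10); (6,10); (2,22); (2,26); (2,30); (2,34); (2,40); (2,44); (2,59); (2,66); (2,70);
     (2,74); (2,20); (2,24); (2,94); (2,98); (2,111); (2,103); (2,52); (2,56); (10,36); (2,75);
     (2,71); (2,67); (2,63); (2,47); (2,64); (2,39); (2,35); (2,31); (2,68); (2,28); (2,7);
     (2,25); (2,45); (2,49); (2,16); (2,60); (6,94); (10,20); (2,81); (2,85); (2,89); (10,47);
     (2,100); (2,96); (2,92); (6,98); (2,48); (2,12); (6,111); (6,81); (6,69); (6,76); (6,56);
     (10,28)]%num.

Definition orbits277 : seq (N * N) :=
  [:: (2,4); (2,3); (2,26); (2,30); (2,34); (2,38); (5,6); (2,50); (2,54); (2,58); (2,62);
     (2,66); (2,70); (2,78); (2,86); (2,90); (2,94); (2,98); (2,76); (2,106); (2,110); (2,72);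
     (2,8); (2,103); (2,99); (6,123); (2,87); (6,63); (2,80); (6,44); (2,35); (2,31); (2,5);
     (2,36); (2,40); (2,25); (2,100); (2,60); (6,78); (6,126); (6,58); (6,46); (2,77); (2,81);
     (2,85); (10,20); (2,97); (2,101); (2,105); (6,110); (2,117); (2,121); (6,79); (2,88);
     (2,24); (2,20); (10,18); (6,12); (6,50); (6,62); (10,88); (6,111); (6,105); (6,93); (6,11);
     (6,17); (6,49); (10,105)]%num.

Lemma check37 : check_table (N.of_nat 37) (orbit_table 37 31 4 orbits37).
Proof. by vm_compute. Qed.

Lemma check61 : check_table (N.of_nat 61) (orbit_table 61 8 20 orbits61).
Proof. by vm_compute. Qed.

Lemma check73 : check_table (N.of_nat 73) (orbit_table 73 10 8 orbits73).
Proof. by vm_compute. Qed.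

Lemma check109 : check_table (N.of_nat 109) (orbit_table 109 33 4 orbits109).
Proof. by vm_compute. Qed.

Lemma check157 : check_table (N.of_nat 157) (orbit_table 157 125 52 orbits157).
Proof. by vm_compute. Qed.

Lemma check181 : check_table (N.of_nat 181) (orbit_table 181 150 20 orbits181).
Proof. by vm_compute. Qed.

Lemma check229 : check_table (N.of_nat 229) (orbit_table 229 216 76 orbits229).
Proof. by vm_compute. Qed.

Lemma check277 : check_table (N.of_nat 277) (orbit_table 277 125 92 orbits277).
Proof. by vm_compute. Qed.

(** * Equianharmonic quadruples *)

Section EquianharmonicDesign.

Local Open Scope ring_scope.

(** [z] is a primitive cube root of unity, [sq] stands for being a nonzero square in a field where
    -1 is not one, and [pr] is an odd involution pairing each nonzero element with a neighbour. *)
Variables (F : fieldType) (z : F) (sq : pred F) (pr : F -> F).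
Hypothesis three_neq0 : 3%:R != 0 :> F.
Hypothesis zP : 1 + z + z ^+ 2 = 0.
Hypothesis sqN : forall x, x != 0 -> sq (- x) = ~~ sq x.
Hypothesis sqM2 : forall x y, y != 0 -> sq (x * y ^+ 2) = sq x.
Hypothesis prP : forall j, j != 0 ->
  [/\ pr j != 0, pr (pr j) = j, pr (- j) = - pr j & pr j = j + 1 \/ pr j = j - 1].

(* For distinct [a], [b], [c] the point [num a b c / den a b c] is the point d for which the
   cross-ratio of (a, b; c, d) is a primitive sixth root of unity; it is infinite when
   [den a b c = 0], that is when a, b, c is an equilateral triangle. *)
Definition den (a b c : F) := a + z * b - (1 + z) * c.
Definition num (a b c : F) := (1 + z) * a * b - z * a * c - b * c.

(** The two primitive sixth roots of unity offer two fourth points, which exchanging [a] and [b]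
    interchanges. The quadratic character of this alternating product also changes under the
    exchange, so it makes a choice independent of the order. *)
Definition orient (a b c : F) := sq ((a - b) * (b - c) * (c - a)).

Definition fourth (a b c : F) : F + F :=
  if den a b c == 0 then inr ((a + b + c) / 3%:R) else inl (num a b c / den a b c).

Definition eq_h (a b c : F) : F + F :=
  if orient a b c then fourth a b c else fourth b a c.

(** The image of [b] under the rotation about [a] by the primitive sixth root of unity [1 + z], that
    is, the third vertex of an equilateral triangle. [third] takes the triangle whose orientation
    makes [eq_h] leave the level. *)
Definition apex (a b : F) := (1 + z) * b - z * a.
Definition third (a b : F) := if sq (a - b) then apex a b else apex b a.
Definition center (a b : F) := (a + b + third a b) / 3%:R.

Definition eq_k (a b w : F) : F + F :=
  let m := center a b in
  if w == m then inl (third a b) else inr (m + (b - a) * pr ((w - m) / (b - a))).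

Let z_neq0 : z != 0.
Proof. by apply: contra_eq_neq zP => ->; rewrite expr0n /= !addr0 oner_eq0. Qed.

Let Nz : - (1 + z) = z ^+ 2.
Proof. by apply/eqP; rewrite -subr_eq0 -oppr_eq0 opprB addrC opprK -zP. Qed.

Let sqz x : sq (z * x) = sq x.
Proof.
have z4 : z = (z ^+ 2) ^+ 2.
  have -> : (z ^+ 2) ^+ 2 = z + (1 + z + z ^+ 2) * (z ^+ 2 - z) by ring.
  by rewrite zP mul0r addr0.
by rewrite z4 mulrC sqM2 // expf_neq0.
Qed.

(** Numerator and denominator gain the same factor [z] under a cyclic shift, so [fourth] is
    cyclically symmetric. *)
Let den_cyc a b c : den c a b = z * den a b c.
Proof.
have -> : den c a b = z * den a b c + (1 + z + z ^+ 2) * (c - b) by rewrite /den; ring.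
by rewrite zP mul0r addr0.
Qed.

Let num_cyc a b c : num c a b = z * num a b c.
Proof.
have -> : num c a b = z * num a b c + (1 + z + z ^+ 2) * (c * a - a * b).
  by rewrite /num; ring.
by rewrite zP mul0r addr0.
Qed.

Let fourth_cyc a b c : fourth c a b = fourth a b c.
Proof.
rewrite /fourth den_cyc num_cyc mulf_eq0 (negbTE z_neq0) /=.
case: ifP => _; first by congr (inr (_ / _)); ring.
by rewrite -mulf_div divff // mul1r.
Qed.

Let disc_neq0 (a b c : F) : uniq [:: a; b; c] -> (a - b) * (b - c) * (c - a) != 0.
Proof.
rewrite /= !inE negb_or andbT => /andP[/andP[ab ac] bc].
by rewrite !mulf_neq0 // subr_eq0 // eq_sym.
Qed.

Let orientC (a b c : F) : uniq [:: a; b; c] -> orient b a c = ~~ orient a b c.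
Proof. by move=> u; rewrite /orient -sqN ?disc_neq0 //; congr sq; ring. Qed.

Let orientCA (a b c : F) : uniq [:: a; b; c] -> orient a c b = ~~ orient a b c.
Proof. by move=> u; rewrite /orient -sqN ?disc_neq0 //; congr sq; ring. Qed.

Let eq_hC (a b c : F) : uniq [:: a; b; c] -> eq_h b a c = eq_h a b c.
Proof. by move=> u; rewrite /eq_h orientC //; case: orient. Qed.

Let eq_hCA (a b c : F) : uniq [:: a; b; c] -> eq_h a c b = eq_h a b c.
Proof.
move=> u; rewrite /eq_h orientCA //; case: orient => /=; first exact: fourth_cyc.
by rewrite -(fourth_cyc b) fourth_cyc.
Qed.

Let thirdC a b : a != b -> third b a = third a b.
Proof. by move=> ab; rewrite /third -opprB sqN ?subr_eq0 //; case: sq. Qed.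

Let centerC a b : a != b -> center b a = center a b.
Proof. by move=> ab; rewrite /center thirdC // [b + a]addrC. Qed.

(** The directed sides [a - b], [b - c], [c - a] have ratios [1 : z : z ^+ 2]. Since [z] is a square
    they have the same character, so every side determines the same triangle. *)
Let apexP (a b : F) : a != b -> sq (a - b) -> let c := apex a b in
  [/\ uniq [:: a; b; c], orient a b c, den a b c = 0, third a c = b & third b c = a].
Proof.
move=> ab s c; have ba : b - a != 0 by rewrite subr_eq0 eq_sym.
have z1 : 1 + z != 0 by rewrite -oppr_eq0 Nz expf_neq0.
have ca : c - a = (1 + z) * (b - a) by rewrite /c /apex; ring.
have cb : c - b = z * (b - a) by rewrite /c /apex; ring.
have zz : (1 + z) * z = -1.
  have -> : (1 + z) * z = -1 + (1 + z + z ^+ 2) by ring.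
  by rewrite zP addr0.
have zz2 : (1 + z) ^+ 2 = z.
  have -> : (1 + z) ^+ 2 = z + (1 + z + z ^+ 2) by ring.
  by rewrite zP addr0.
split.
- have can : c != a by rewrite -subr_eq0 ca mulf_neq0.
  have cbn : c != b by rewrite -subr_eq0 cb mulf_neq0.
  by rewrite /= !inE negb_or ab !(eq_sym _ c) can cbn.
- rewrite /orient -(opprB c) cb ca.
  have -> : (a - b) * - (z * (b - a)) * ((1 + z) * (b - a)) =
    - ((1 + z) * z) * (a - b) * (b - a) ^+ 2 by ring.
  by rewrite zz opprK mul1r sqM2.
- rewrite /den /c /apex.
  have -> : a + z * b - (1 + z) * ((1 + z) * b - z * a) =
    a * (1 + (1 + z) * z) + b * (z - (1 + z) ^+ 2) by ring.
  by rewrite zz zz2 subrr !subrr !mulr0 addr0.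
- have e : a - c = - (z ^+ 2 * (a - b)) by rewrite -Nz -opprB ca; ring.
  rewrite /third e sqN; last by rewrite mulf_neq0 ?expf_neq0 // subr_eq0.
  rewrite mulrC sqM2 // s /= /apex /c /apex.
  have -> : (1 + z) * a - z * ((1 + z) * b - z * a) =
    (1 + z + z ^+ 2) * a - (1 + z) * z * b by ring.
  by rewrite zP zz mul0r mulN1r opprK add0r.
- have e : b - c = z * (a - b) by rewrite -opprB cb; ring.
  rewrite /third e sqz s /apex /c /apex.
  have -> : (1 + z) * ((1 + z) * b - z * a) - z * b =
    ((1 + z) ^+ 2 - z) * b - (1 + z) * z * a by ring.
  by rewrite zz zz2 subrr mul0r mulN1r opprK add0r.
Qed.

Let thirdP (a b : F) : a != b -> let c := third a b in
  [/\ c \notin [:: a; b], eq_h a b c = inr (center a b), third a c = b & center a c = center a b].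
Proof.
move=> ab c.
have main x y : x != y -> sq (x - y) ->
    [/\ uniq [:: x; y; third x y], eq_h x y (third x y) = inr (center x y),
      third x (third x y) = y & third y (third x y) = x].
  move=> xy s; have [u o d t1 t2] := apexP xy s.
  have e : third x y = apex x y by rewrite /third s.
  by rewrite e; split=> //; rewrite /eq_h o /fourth d eqxx /center e.
have [u hc tc] : [/\ uniq [:: a; b; c], eq_h a b c = inr (center a b) & third a c = b].
  case s: (sq (a - b)); first by have [] := main _ _ ab s.
  have ba : b != a by rewrite eq_sym.
  have [|u hc t1 t2] := main _ _ ba; first by rewrite -opprB sqN ?subr_eq0 // s.
  rewrite thirdC // in u hc t1 t2; rewrite /c.
  have u' : uniq [:: a; b; third a b].
    by rewrite -(perm_uniq (s1 := [:: b; a; third a b])) //; apply/permP=> x /=; lia.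
  by split=> //; rewrite -centerC // -eq_hC.
split=> //.
  by move: u; rewrite /= !inE !negb_or andbT ![c == _]eq_sym => /andP[/andP[_ ->] ->].
by rewrite /center tc -/c addrAC.
Qed.

Let eq_k_center a b : eq_k a b (center a b) = inl (third a b).
Proof. by rewrite /eq_k eqxx. Qed.

(** If the fourth point [d] is finite, the factored forms of [a - d], [b - d], [c - d] show that it
    is new. The alternating product of [b, a, d] is [z] times a square times that of [a, b, c], so
    [eq_h] evaluates [fourth b a d], which returns [c]. *)
Let eq_h_orient (a b c : F) : uniq [:: a; b; c] -> orient a b c ->
  match eq_h a b c with
  | inl d => d \notin [:: a; b; c] /\ eq_h a b d = inl c
  | inr w => eq_k a b w = inl c
  end.
Proof.
move=> u o; rewrite {1}/eq_h o /fourth; have := u.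
rewrite /= !inE negb_or andbT => /andP[/andP[ab ac] bc].
have a_b : a - b != 0 by rewrite subr_eq0.
case: eqP => [d0|/eqP dn0].
  (* The equation [den a b c = 0] is linear in [c], and [apex a b] is its solution. *)
  have ec : c = apex a b.
    have -> : c = (1 + z + z ^+ 2) * (c - b) + z * den a b c + apex a b.
      by rewrite /den /apex; ring.
    by rewrite zP d0 mulr0 mul0r !add0r.
  have s : sq (a - b).
    move: o; rewrite /orient.
    have -> : (a - b) * (b - c) * (c - a) = z * (- (1 + z)) * (a - b) * (a - b) ^+ 2.
      by rewrite ec /apex; ring.
    by rewrite sqM2 // -mulrA Nz sqz mulrC sqM2.
  have e : third a b = c by rewrite /third s.
  by rewrite -e -/(center a b) eq_k_center.
set P := den a b c in dn0 *; set d := num a b c / P.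
have dP : d * P = num a b c by rewrite /d divfK.
have da : (a - d) * P = (a - b) * (a - c) by rewrite mulrBl dP /P /num /den; ring.
have db : (b - d) * P = z * (b - a) * (b - c) by rewrite mulrBl dP /P /num /den; ring.
have dc : (c - d) * P = - (1 + z) * (c - a) * (c - b) by rewrite mulrBl dP /P /num /den; ring.
have ca : c != a by rewrite eq_sym.
have cb : c != b by rewrite eq_sym.
have ba : b != a by rewrite eq_sym.
have neq (x y : F) : (x - d) * P = y -> y != 0 -> d != x.
  by move=> <-; apply: contra_neq => ->; rewrite subrr mul0r.
have dna : d != a by apply: neq da _; rewrite mulf_neq0 ?subr_eq0.
have dnb : d != b by apply: neq db _; rewrite !mulf_neq0 ?subr_eq0.
have dnc : d != c by apply: neq dc _; rewrite Nz !mulf_neq0 ?expf_neq0 ?subr_eq0.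
split; first by rewrite !negb_or dna dnb dnc.
have u' : uniq [:: b; a; d] by rewrite /= !inE negb_or ba !(eq_sym _ d) dna dnb.
have o' : orient b a d.
  rewrite /orient (_ : _ * _ * _ = z * (((a - b) * (b - c) * (c - a)) * ((a - b) / P) ^+ 2)).
    by rewrite sqz sqM2 // mulf_neq0 ?invr_neq0.
  apply: (mulIf dn0); apply: (mulIf dn0).
  have -> : (b - a) * (a - d) * (d - b) * P * P = - (b - a) * ((a - d) * P) * ((b - d) * P).
    by ring.
  by rewrite da db; field.
rewrite (eq_hC u') /eq_h o' /fourth.
have dP' : den b a d * P = z * (a - b) ^+ 2.
  have -> : den b a d * P = (b + z * a) * P - (1 + z) * (d * P) by rewrite /den; ring.
  by rewrite dP /P /den /num; ring.
have dn' : den b a d != 0.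
  by apply: contra_eq_neq dP' => ->; rewrite mul0r eq_sym mulf_neq0 ?expf_neq0.
rewrite (negbTE dn'); congr inl; apply: (mulIf dn'); rewrite divfK //.
apply: (mulIf dn0); rewrite -mulrA dP'.
have -> : num b a d * P = (1 + z) * a * b * P - (z * b + a) * (d * P) by rewrite /num; ring.
by rewrite dP /P /den /num; ring.
Qed.

(** The delicate point is the symmetry of the mixed blocks: the pair [- w], [- w'] again has
    difference [b - a] up to sign, and relative to its center the points [- a] and [- b] are again
    matched by [pr]. *)
Lemma equianharmonic_two_levels : two_levels eq_h eq_k.
Proof.
(* Exchanging [a] and [b] negates the coordinate [(w - m) / (b - a)], and [pr] commutes with
   negation. *)
have kC a b w : a != b -> eq_k b a w = eq_k a b w.
  move=> ab; rewrite /eq_k centerC // thirdC //; case: eqP => // /eqP wm.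
  have wn : (w - center a b) / (b - a) != 0.
    by rewrite mulf_neq0 ?invr_neq0 // subr_eq0 // eq_sym.
  have [_ _ pN _] := prP wn.
  by rewrite -[a - b]opprB invrN mulrN pN mulrNN.
have centerD d a b : center (a + d) (b + d) = center a b + d.
  rewrite /center /third (_ : a + d - (b + d) = a - b); last by ring.
  by case: ifP => _; rewrite /apex; field.
have thirdD d a b : third (a + d) (b + d) = third a b + d.
  rewrite /third (_ : a + d - (b + d) = a - b); last by ring.
  by case: ifP => _; rewrite /apex; ring.
split=> //.
- move=> a b c u; case o: (orient a b c); first exact: eq_h_orient.
  have u' : uniq [:: b; a; c].
    by rewrite -(perm_uniq (s1 := [:: a; b; c])) //; apply/permP=> x /=; lia.
  have := @eq_h_orient b a c u'; rewrite orientC // o => /(_ isT).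
  have ab : a != b by move: u; rewrite /= !inE negb_or => /andP[/andP[]].
  rewrite eq_hC //; case: (eq_h a b c) => [d [dN hd]|w]; last by rewrite kC.
  move: dN; rewrite !inE !negb_or => /and3P[db da dc].
  split; first by rewrite da db dc.
  by rewrite -eq_hC // /= !inE negb_or ab !(eq_sym _ d) da db.
- move=> a b w ab; rewrite {1}/eq_k; case: eqP => [->|/eqP wm].
    have [cN hc tc cc] := thirdP ab; split=> //.
    by rewrite -cc eq_k_center tc.
  set m := center a b; set j := (w - m) / (b - a).
  have ba : b - a != 0 by rewrite subr_eq0 eq_sym.
  have j0 : j != 0 by rewrite mulf_neq0 ?invr_neq0 // subr_eq0.
  have [p0 pp pN p1] := prP j0.
  have wE : w = m + (b - a) * j by rewrite /j mulrC divfK // addrC subrK.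
  have neq : m + (b - a) * pr j != w.
    rewrite [X in _ != X]wE (inj_eq (addrI m)) (inj_eq (mulfI ba)).
    case: p1 => ->; rewrite -[X in _ != X]addr0 (inj_eq (addrI j)) ?oppr_eq0 oner_eq0 //.
  split=> //.
    have w'm : m + (b - a) * pr j != m.
      by rewrite -[X in _ != X]addr0 (inj_eq (addrI m)) mulf_neq0.
    rewrite /eq_k -/m (negbTE w'm).
    have -> : (m + (b - a) * pr j - m) / (b - a) = pr j by rewrite addrAC subrr add0r mulrC mulKf.
    by rewrite pp -wE.
  rewrite /eq_k.
  (* By translation, [center x y - x] depends only on [y - x], so the center of the reflected pair
     can be expressed by [m]. *)
  have cE x y t : y - x = t -> center x y = x + (center a (a + t) - a).
    move=> <-; have := centerD (x - a) a (a + (y - x)).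
    rewrite (_ : a + (x - a) = x); last by ring.
    by rewrite (_ : a + (y - x) + (x - a) = y) => [->|]; [rewrite addrCA | ring].
  have mE : center a (a + (b - a)) = m by rewrite addrC subrK.
  (* If [pr j = j + 1], the reflected pair has difference [- (b - a)] and [- a] has coordinate
     [- (j + 1)]; if [pr j = j - 1], the difference is [b - a] and the coordinate is [j]. *)
  case: p1 => p1; rewrite p1.
    have -> : center (- w) (- (m + (b - a) * (j + 1))) = m - a - (b - a) - w.
      rewrite -centerC; last by rewrite (inj_eq (@oppr_inj _)) -p1 eq_sym.
      rewrite (cE _ _ (b - a)) ?mE; first by rewrite wE; ring.
      by rewrite wE; ring.
    rewrite ifF.
      congr inr.
      have -> : - (m + (b - a) * (j + 1)) - - w = - (b - a) by rewrite wE; ring.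
      have -> : (- a - (m - a - (b - a) - w)) / - (b - a) = - (j + 1).
        rewrite wE invrN mulrN -mulNr.
        have -> : - (- a - (m - a - (b - a) - (m + (b - a) * j))) = - (j + 1) * (b - a) by ring.
        by rewrite mulfK.
      have [_ _ pN' _] := prP p0.
      by rewrite -p1 pN' pp wE; ring.
    rewrite wE (_ : m - a - (b - a) - (m + (b - a) * j) = - a - (b - a) * (j + 1)); last by ring.
    rewrite -[X in X == _]addr0 (inj_eq (addrI _)) eq_sym oppr_eq0 mulf_eq0 (negbTE ba) -p1.
    exact: negbTE.
  have -> : center (- w) (- (m + (b - a) * (j - 1))) = m - a - w.
    rewrite (cE _ _ (b - a)) ?mE; first by ring.
    by rewrite wE; ring.
  rewrite ifF.
    congr inr.
    have -> : - (m + (b - a) * (j - 1)) - - w = b - a by rewrite wE; ring.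
    have -> : (- a - (m - a - w)) / (b - a) = j by rewrite /j; congr (_ / _); ring.
    by rewrite p1 wE; ring.
  rewrite (_ : m - a - w = - a + (m - w)); last by ring.
  rewrite -[X in X == _]addr0 (inj_eq (addrI _)) eq_sym subr_eq0 eq_sym.
  exact: negbTE.
- move=> d a b c.
  have fourthD x y t : fourth (x + d) (y + d) (t + d) = shift_sum d (fourth x y t).
    rewrite /fourth (_ : den (x + d) _ _ = den x y t); last by rewrite /den; ring.
    case: eqP => [_|/eqP dn] /=; first by congr inr; field.
    congr inl; rewrite (_ : num _ _ _ = num x y t + d * den x y t); last first.
      by rewrite /num /den; ring.
    by rewrite mulrDl mulfK.
  rewrite /eq_h (_ : orient (a + d) _ _ = orient a b c); first by case: ifP.
  by rewrite /orient; congr sq; ring.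
- move=> d a b w; rewrite /eq_k centerD thirdD (inj_eq (addIr d)).
  case: ifP => _ //=; congr inr.
  rewrite (_ : w + d - _ = w - center a b); last by ring.
  by rewrite (_ : b + d - _ = b - a); ring.
Qed.

End EquianharmonicDesign.

(** * Squares, cube roots of unity and the pairing modulo p *)

Section PrimeSevenModTwelve.

Local Open Scope ring_scope.

Variable p : nat.
Hypotheses (p_pr : prime p) (p7 : (p %% 12 = 7)%N).

Let p_odd : odd p. Proof. lia. Qed.

Let nat_neq0 m : (0 < m < p)%N -> m%:R != 0 :> 'F_p.
Proof.
by case/andP=> m0 mp; rewrite -(inj_eq val_inj) /= val_Fp_nat // modn_small // -lt0n.
Qed.

Let fermat (x : 'F_p) : x != 0 -> x ^+ p.-1 = 1.
Proof.
move=> x0; apply: (mulfI x0); rewrite -exprS prednK ?prime_gt0 // mulr1.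
by have := expf_card x; rewrite card_Fp.
Qed.

Let cube_root : exists z : 'F_p, 1 + z + z ^+ 2 = 0.
Proof.
have n0 : (0 < p.-1)%N by lia.
have /hasP[g _ gP] : has p.-1.-primitive_root (enum (predC1 (0 : 'F_p))).
  apply: has_prim_root => //; first apply/allP=> x.
  - by rewrite mem_enum inE /= => x0; rewrite unity_rootE fermat.
  - exact: enum_uniq.
  - by rewrite -cardE cardC1 card_Fp.
have d3 : (3 * (p.-1 %/ 3) = p.-1)%N by lia.
pose z := g ^+ (p.-1 %/ 3); exists z.
have z1 : z != 1 by rewrite -(prim_order_dvd gP); apply/negP => /dvdn_leq; lia.
have z3 : z ^+ 3 = 1 by rewrite -exprM mulnC d3 prim_expr_order.
apply: (mulfI (x := z - 1)); first by rewrite subr_eq0.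
have -> : (z - 1) * (1 + z + z ^+ 2) = z ^+ 3 - 1 by move: (z) => y; ring.
by rewrite z3 subrr mulr0.
Qed.

(** Euler's criterion. The exponent is odd because p = 3 mod 4, so -1 is not a square. *)
Let sq (x : 'F_p) : bool := x ^+ p.-1./2 == 1.

Let half_odd : odd p.-1./2. Proof. lia. Qed.

Let sqN (x : 'F_p) : x != 0 -> sq (- x) = ~~ sq x.
Proof.
move=> x0; rewrite /sq exprNn -signr_odd half_odd expr1 mulN1r.
have : (x ^+ p.-1./2) ^+ 2 == 1 by rewrite -exprM muln2 (_ : _.*2 = p.-1) ?fermat //; lia.
have two : 2%:R != 0 :> 'F_p by apply: nat_neq0; lia.
rewrite sqrf_eq1; have n1 : (-1 != 1 :> 'F_p).
  by apply: contraNneq two => e; rewrite mulr2n -{1}e addNr.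
by case/orP=> /eqP->; rewrite ?opprK ?eqxx ?(negbTE n1).
Qed.

Let sqM2 (x y : 'F_p) : y != 0 -> sq (x * y ^+ 2) = sq x.
Proof.
move=> y0; rewrite /sq exprMn -exprM mul2n (_ : _.*2 = p.-1); last by lia.
by rewrite fermat // mulr1.
Qed.

(** Parity is that of the representative below p, so the pairs are {1, 2}, {3, 4}, ..., {p - 2, p -
    1}. As p is odd, j and p - j have opposite parity for nonzero j, so negation permutes these
    pairs. *)
Let pr (j : 'F_p) : 'F_p := if odd j then j + 1 else j - 1.

Let F_lt (x : 'F_p) : (x < p)%N.
Proof. by have := ltn_ord x; rewrite [X in (_ < X)%N](Fp_cast p_pr). Qed.

Let val_add1 (j : 'F_p) : odd j -> (j + 1 : 'F_p) = j.+1 :> nat.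
Proof.
move=> o; have := F_lt j.
have -> : (j + 1 : 'F_p) = ((j + 1) %% p)%N :> nat.
  by rewrite /= modnDmr [X in (_ %% X)%N](Fp_cast p_pr).
by move=> l; rewrite modn_small; lia.
Qed.

Let val_opp (j : 'F_p) : j != 0 -> (- j : 'F_p) = (p - j)%N :> nat.
Proof.
rewrite -(inj_eq val_inj) -lt0n /= => j0.
rewrite {1}(Fp_cast p_pr) [X in (_ %% X)%N](Fp_cast p_pr) modn_small //.
by have := F_lt j; lia.
Qed.

Let odd_opp (j : 'F_p) : j != 0 -> odd (- j : 'F_p) = ~~ odd j.
Proof. by move=> j0; rewrite val_opp // oddB ?p_odd // ltnW. Qed.

Let val_sub1 (j : 'F_p) : j != 0 -> ~~ odd j -> (j - 1 : 'F_p) = j.-1 :> nat.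
Proof.
move=> jn _; have j0 : (0 < j)%N by rewrite lt0n.
have e : j = j.-1%:R + 1 :> 'F_p by rewrite natr1 prednK // natr_Zp.
have -> : j - 1 = j.-1%:R by rewrite {1}e addrK.
rewrite val_Fp_nat // modn_small //.
exact: leq_ltn_trans (leq_pred _) (F_lt j).
Qed.

Let prP (j : 'F_p) : j != 0 ->
  [/\ pr j != 0, pr (pr j) = j, pr (- j) = - pr j & pr j = j + 1 \/ pr j = j - 1].
Proof.
move=> j0; have jn : (0 < j)%N by rewrite lt0n.
have prO (i : 'F_p) : odd i -> pr i = i + 1 by rewrite /pr => ->.
have prE (i : 'F_p) : ~~ odd i -> pr i = i - 1 by rewrite /pr => /negbTE->.
have [o|o] := boolP (odd j).
  have v1 := val_add1 o; rewrite (prO _ o); split; last by left.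
  - by apply/eqP=> /(congr1 (@nat_of_ord _)); rewrite v1.
  - by rewrite prE ?addrK // v1 /= o.
  - by rewrite prE ?odd_opp ?o // opprD.
have v1 := val_sub1 j0 o; have o1 : odd j.-1 by lia.
rewrite (prE _ o); split; last by right.
- by apply/eqP=> /(congr1 (@nat_of_ord _)); rewrite v1 /=; lia.
- by rewrite prO ?subrK // v1.
- by rewrite prO ?odd_opp // opprB addrC.
Qed.

Lemma equianharmonic_design :
  (exists B : {set {set point 2 p}}, strictly_cyclic_SQS B) /\
  (exists C : {set 'M[bool]_(2, p)}, perfect_OOC_2D C).
Proof.
have [z zP] := cube_root.
have t0 : 3%:R != 0 :> 'F_p by apply: nat_neq0; lia.
have hk := equianharmonic_two_levels t0 zP sqN sqM2 prP.
have := @two_levels_exist (pdiv p) _ _ _ _ hk; rewrite pdiv_id //; apply=> //.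
exact: prime_gt1.
Qed.

End PrimeSevenModTwelve.

Theorem theorem4p5 (p : nat) :
  (prime p /\ p %% 12 = 7) \/ p \in [:: 37; 61; 73; 109; 157; 181; 229; 277] ->
  (exists B : {set {set point 2 p}}, strictly_cyclic_SQS B) /\
  (exists C : {set 'M[bool]_(2, p)}, perfect_OOC_2D C).
Proof.
case=> [[p_pr p7]|]; first exact: equianharmonic_design.
rewrite !inE.
case/or4P => [/eqP->|/eqP->|/eqP->|].
- exact: (@table_design 37 isT _ isT isT check37).
- exact: (@table_design 61 isT _ isT isT check61).
- exact: (@table_design 73 isT _ isT isT check73).
case/or4P => [/eqP->|/eqP->|/eqP->|/orP[/eqP->|/eqP->]].
- exact: (@table_design 109 isT _ isT isT check109).
- exact: (@table_design 157 isT _ isT isT check157).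
- exact: (@table_design 181 isT _ isT isT check181).
- exact: (@table_design 229 isT _ isT isT check229).
- exact: (@table_design 277 isT _ isT isT check277).
Qed.
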